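(* (a) Among the 155 subvarieties of $\mathcal S$ defined, relative to $\mathcal S$, by the 155 weak associative laws of length $m\le 4$, there are exactly 6 distinct ones, namely $$\mathcal{SL},\quad 43\mathcal A12,\quad 43\mathcal A23,\quad 42\mathcal A12,\quad 43\mathcal F25,\quad \mathcal S .$$ That is, each of the 155 varieties equals one of these six, each of these six is among the 155 varieties, and these six are pairwise distinct. (b) They satisfy the following relationships (where $\subset$ denotes proper inclusion): 1. $\mathcal{SL} \subset 43\mathcal A23 \subset 43\mathcal F25 \subset \mathcal S$; 2. $\mathcal{SL} \subset 43\mathcal A12 \subset 42\mathcal A12 \subset \mathcal S$; 3. $\mathcal{BA} \subset 43\mathcal A12 \subset 43\mathcal F25$; 4. $43\mathcal A12 \not\subseteq 43\mathcal A23$ and $43\mathcal A23 \not\subseteq 43\mathcal A12$; 5. $42\mathcal A12 \not\subseteq 43\mathcal F25$ and $43\mathcal F25 \not\subseteq 42\mathcal A12$.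
   Context: A zroupoid is an algebra $\mathbf A=\langle A,\to,0\rangle$ with $\to$ binary and $0$ a constant; write $x':=x\to 0$. An implication zroupoid is a zroupoid satisfying $(x\to y)\to z\approx((z'\to x)\to(y\to z)')'$ and $0''\approx 0$. The variety $\mathcal S$ of symmetric implication zroupoids consists of the implication zroupoids satisfying $x''\approx x$ and $(x\to y')'\approx(y\to x')'$. $\mathcal{SL}$ is the variety of implication zroupoids satisfying $x'\approx x$ and $x\to y\approx y\to x$. $\mathcal{BA}$ is the variety of implication zroupoids satisfying $(x\to y)\to x\approx x$ and $x\to x\approx 0'$. Weak associative laws. Bracketings of a word of length 3, $\langle a_1,a_2,a_3\rangle$: 1: $a_1\to(a_2\to a_3)$; 2: $(a_1\to a_2)\to a_3$. Bracketings of a word of length 4, $\langle a_1,a_2,a_3,a_4\rangle$: 1: $a_1\to(a_2\to(a_3\to a_4))$; 2: $a_1\to((a_2\to a_3)\to a_4)$; 3: $(a_1\to a_2)\to(a_3\to a_4)$; 4: $(a_1\to(a_2\to a_3))\to a_4$; 5: $((a_1\to a_2)\to a_3)\to a_4$. For a word $X$ of length $n$ with $m$ distinct variables, $(nmXpq)$ is the identity ''bracketing $p$ of $X$ $\approx$ bracketing $q$ of $X$'', and $nm\mathcal Xpq$ is the subvariety of $\mathcal S$ defined by it. The words are: $n=3,m=1$: $A=\langle x,x,x\rangle$; $n=3,m=2$: $A=\langle x,x,y\rangle$, $B=\langle x,y,x\rangle$, $C=\langle x,y,y\rangle$; $n=3,m=3$: $A=\langle x,y,z\rangle$; $n=4,m=1$: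 $A=\langle x,x,x,x\rangle$; $n=4,m=2$: $A=\langle x,x,x,y\rangle$, $B=\langle x,x,y,x\rangle$, $C=\langle x,x,y,y\rangle$, $D=\langle x,y,x,x\rangle$, $E=\langle x,y,x,y\rangle$, $F=\langle x,y,y,x\rangle$, $G=\langle x,y,y,y\rangle$; $n=4,m=3$: $A=\langle x,x,y,z\rangle$, $B=\langle x,y,x,z\rangle$, $C=\langle x,y,y,z\rangle$, $D=\langle x,y,z,x\rangle$, $E=\langle x,y,z,y\rangle$, $F=\langle x,y,z,z\rangle$; $n=4,m=4$: $A=\langle t,x,y,z\rangle$. The 155 weak associative laws of length $\le 4$ are all $(nmXpq)$ with $X$ in this list and $p<q$ (so $p,q\in\{1,2\}$ if $n=3$, $p,q\in\{1,\dots,5\}$ if $n=4$). In particular: $42\mathcal A12$ is defined by $x\to(x\to(x\to y))\approx x\to((x\to x)\to y)$; $43\mathcal A12$ by $x\to(x\to(y\to z))\approx x\to((x\to y)\to z)$; $43\mathcal A23$ by $x\to((x\to y)\to z)\approx(x\to x)\to(y\to z)$; $43\mathcal F25$ by $x\to((y\to z)\to z)\approx((x\to y)\to z)\to z$. *)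

(* Defs.v *)
From mathcomp Require Import all_boot.
From mathcomp Require Import boolp classical_sets.

Set Implicit Arguments.
Unset Strict Implicit.
Unset Printing Implicit Defensive.

Local Open Scope classical_set_scope.

Record zroupoid := Zroupoid {
  carrier :> Type;
  imp : carrier -> carrier -> carrier;
  zero : carrier
}.

Arguments zero {z}.

Declare Scope zroupoid_scope.
Delimit Scope zroupoid_scope with Z.
Local Open Scope zroupoid_scope.

Notation "x ~> y" := (imp x y)
  (at level 55, no associativity) : zroupoid_scope.

Definition neg (A : zroupoid) (x : A) : A := x ~> zero.

Notation "x ^'" := (neg x) : zroupoid_scope.

(* A variety is represented by the class of its members. *)

Definition implication_zroupoids : set zroupoid := [set A : zroupoid |
  (forall x y z : A, (x ~> y) ~> z = ((z^' ~> x) ~> (y ~> z)^')^') /\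
  (zero : A)^'^' = zero].

Definition symmetric_implication_zroupoids : set zroupoid := implication_zroupoids `&`
  [set A : zroupoid |
    (forall x : A, x^'^' = x) /\
    (forall x y : A, (x ~> y^')^' = (y ~> x^')^')].

Definition SL : set zroupoid := implication_zroupoids `&`
  [set A : zroupoid |
    (forall x : A, x^' = x) /\ (forall x y : A, x ~> y = y ~> x)].

Definition BA : set zroupoid := implication_zroupoids `&`
  [set A : zroupoid |
    (forall x y : A, (x ~> y) ~> x = x) /\
    (forall x : A, x ~> x = zero^')].

(* The [p]-th bracketing of the word [s], for [size s = 3] and [1 <= p <= 2],
   or [size s = 4] and [1 <= p <= 5]; the last branch is a junk value. *)
Definition bracketing (A : zroupoid) (p : nat) (s : seq A) : A :=
  match s, p with
  | [:: a1; a2; a3], 1 => a1 ~> (a2 ~> a3)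
  | [:: a1; a2; a3], 2 => (a1 ~> a2) ~> a3
  | [:: a1; a2; a3; a4], 1 => a1 ~> (a2 ~> (a3 ~> a4))
  | [:: a1; a2; a3; a4], 2 => a1 ~> ((a2 ~> a3) ~> a4)
  | [:: a1; a2; a3; a4], 3 => (a1 ~> a2) ~> (a3 ~> a4)
  | [:: a1; a2; a3; a4], 4 => (a1 ~> (a2 ~> a3)) ~> a4
  | [:: a1; a2; a3; a4], 5 => ((a1 ~> a2) ~> a3) ~> a4
  | _, _ => zero
  end.

Definition nb_bracketings (n : nat) : nat :=
  match n with 3 => 2 | 4 => 5 | _ => 0 end.

(* A word is a sequence of variables, and variables are natural numbers. *)
Definition word := seq nat.

Section Words.
Let x := 0.
Let y := 1.
Let z := 2.
Let t := 3.

Definition w31A : word := [:: x; x; x].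

Definition w32A : word := [:: x; x; y].
Definition w32B : word := [:: x; y; x].
Definition w32C : word := [:: x; y; y].

Definition w33A : word := [:: x; y; z].

Definition w41A : word := [:: x; x; x; x].

Definition w42A : word := [:: x; x; x; y].
Definition w42B : word := [:: x; x; y; x].
Definition w42C : word := [:: x; x; y; y].
Definition w42D : word := [:: x; y; x; x].
Definition w42E : word := [:: x; y; x; y].
Definition w42F : word := [:: x; y; y; x].
Definition w42G : word := [:: x; y; y; y].

Definition w43A : word := [:: x; x; y; z].
Definition w43B : word := [:: x; y; x; z].
Definition w43C : word := [:: x; y; y; z].
Definition w43D : word := [:: x; y; z; x].
Definition w43E : word := [:: x; y; z; y].
Definition w43F : word := [:: x; y; z; z].

Definition w44A : word := [:: t; x; y; z].
End Words.

Definition words : seq word :=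
  [:: w31A; w32A; w32B; w32C; w33A; w41A;
      w42A; w42B; w42C; w42D; w42E; w42F; w42G;
      w43A; w43B; w43C; w43D; w43E; w43F; w44A].

(* The triple [(w, p, q)] stands for the identity
   "bracketing [p] of [w] = bracketing [q] of [w]". *)
Definition law : Type := (word * nat * nat)%type.

Definition weak_associative_laws : seq law :=
  [seq (w, pq.1, pq.2) | w <- words,
     pq <- [seq pq <- [seq (p, q) | p <- iota 1 (nb_bracketings (size w)),
                                    q <- iota 1 (nb_bracketings (size w))]
           | pq.1 < pq.2]].

Lemma size_weak_associative_laws : size weak_associative_laws = 155.
Proof. by []. Qed.

Lemma uniq_weak_associative_laws : uniq weak_associative_laws.
Proof. by []. Qed.

Definition satisfies (A : zroupoid) (l : law) : Prop :=
  let: (w, p, q) := l in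
  forall v : nat -> A, bracketing p (map v w) = bracketing q (map v w).

Definition law_variety (l : law) : set zroupoid :=
  symmetric_implication_zroupoids `&` [set A | satisfies A l].

Definition V42A12 : set zroupoid := law_variety (w42A, 1, 2).
Definition V43A12 : set zroupoid := law_variety (w43A, 1, 2).
Definition V43A23 : set zroupoid := law_variety (w43A, 2, 3).
Definition V43F25 : set zroupoid := law_variety (w43F, 2, 5).

Definition six_varieties : 6.-tuple (set zroupoid) :=
  [tuple SL; V43A12; V43A23; V42A12; V43F25; symmetric_implication_zroupoids].

(* Main.v *)
Require Import Defs.
From mathcomp Require Import all_boot.
From mathcomp Require Import boolp classical_sets.

(* In a symmetric implication zroupoid put x /\ y := (x -> y')' and
   x \/ y := x' -> y. The axioms say exactly that /\ and \/ are commutative,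
   distribute over each other, have the units 1 := 0' and 0, and are exchanged by
   the involution '. Idempotence and associativity follow, so members of S are
   distributive bisemilattices with involution, which are Plonka sums of
   distributive lattices; the fibre of x is recorded by [supp x] := x /\ 0.
   Hence an identity holds in S iff its two sides contain the same literals
   (variables x and negated variables x', after pushing ' inwards) and define the
   same monotone Boolean function of these literals.
   In a given A in S, a weak associative law fails to be automatic for at most
   three reasons, and each of them amounts to one property of A:
   - its sides contain different literals: [same_supp], i.e. x and x' lie in the
     same fibre;
   - its sides differ as Boolean functions: [degenerate], i.e. 0 = 1;
   - its sides differ as monotone functions of the literals: [boolean_fibres],
     i.e. x \/ x' is the top of its fibre.
   So a law is determined by its [profile], three bits whose last one implies the
   second; all six possible profiles occur, and three small algebras separate
   them. *)

Set Implicit Arguments.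
Unset Strict Implicit.
Unset Printing Implicit Defensive.

Local Open Scope classical_set_scope.
Local Open Scope Z.

(* [classical_sets] also exports a constant named [zero]. *)
Local Notation zero := Defs.zero.
Local Notation one := (neg zero).

(** * Distributive bisemilattices *)

Section DistributiveBisemilattice.
Variables (T : Type) (m j : T -> T -> T) (o i : T).
Hypotheses (mC : commutative m) (jC : commutative j).
Hypotheses (m1 : right_id i m) (j0 : right_id o j).
Hypotheses (jmr : right_distributive j m) (mjr : right_distributive m j).

Local Notation "x * y" := (m x y).
Local Notation "x + y" := (j x y).
Local Notation "0" := o.
Local Notation "1" := i.

Let mjl : left_distributive m j.
Proof. by move=> x y z; rewrite mC mjr !(mC z). Qed.

(** Distributing x + 0 * 0 gives x * x = x + 0 * 0, so only 0 * 0 = 0 remains; it comes from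
    expanding 0 = 0 * (1 * 1). *)
Lemma distributive_units_idem : idempotent_op m.
Proof.
have sq x : x * x = x + 0 * 0 by rewrite jmr j0.
have H : 0 * (0 * 0) = 0.
  by rewrite -[RHS]m1 -[X in _ = 0 * X]m1 (sq 1) mjr m1 jC j0.
have c0 : 0 * 0 = 0.
  by rewrite -[RHS]H (sq 0) mjr H j0 jC j0.
by move=> x; rewrite sq c0 j0.
Qed.

Hypothesis jj : idempotent_op j.
Let mm := distributive_units_idem.

(** Absorption fails only by the support y * 0: both x * (x + y) and x + x * y equal x + y * 0. In
    the names below, [e] refers to such supports. *)
Let add0 x y : x + y * 0 = x * (x + y).
Proof. by rewrite jmr j0 mC. Qed.
Let addMe x y : x + x * y = x + y * 0.
Proof. by rewrite add0 jmr jj. Qed.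
Let mul1 x y : x * (y + 1) = x + y * 0.
Proof. by rewrite mjr m1 jC addMe. Qed.
Let add_e x : x + x * 0 = x.
Proof. by rewrite add0 jj mm. Qed.
Let mul_e x : x * (x * 0) = x * 0.
Proof. by rewrite -{1}(add_e x) mC (jC x) -add0 jj. Qed.
Let mul_add_e x y : x * (y + x * 0) = x * y.
Proof. by rewrite mjr mul_e -mjr j0. Qed.
Let one_e x : 1 + x * 0 = 1 + x.
Proof. by rewrite add0 mC m1. Qed.
Let one_join x y : 1 + (x + y) = 1 + x * y.
Proof.
rewrite -(one_e (x + y)) mjl add0 mC jmr one_e -jmr.
by rewrite mC (jC (x * 0)) mul_add_e.
Qed.
Let e_e x : x * 0 * 0 = x * 0.
Proof.
have H z : z * 0 = 0 * (z + 1) by rewrite mul1 jC j0.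
by rewrite {1}H (jC _ 1) one_e (jC 1) -H.
Qed.
Let e_meet x y : (x * y) * 0 = (x + y) * 0.
Proof.
have H z : z * 0 = 0 * (1 + z) by rewrite (jC 1) mul1 jC j0.
by rewrite !H one_join.
Qed.
Let mul_e_join x y : y * (x * 0) = (x + y) * 0.
Proof. by rewrite mjl -addMe -{2}(e_e x) -mjr (jC 0) j0; apply: mC. Qed.
Let add_mul_e x y : x + y * (x * 0) = x + y * 0.
Proof. by rewrite jmr add_e mC add0. Qed.
Let mul_absorb x y : (x + y * 0) * (x * y) = x * y.
Proof. by rewrite -addMe mC jC -add0 -mjr j0. Qed.
Let mulKm x y : x * (x * y) = x * y.
Proof.
by rewrite mC -mul_add_e e_meet -mul_e_join add_mul_e mC mul_absorb.
Qed.
Let mul_join_meet x y z : (y + z) * (x * y) = x * y + z * 0.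
Proof. by rewrite mjl (mC x) mulKm (mC z) addMe. Qed.
Let mul_add0 x y z : y * (x + z * 0) = x * y + z * 0.
Proof.
rewrite -{2}(e_e z) -mul_join_meet -(add_mul_e y) mul_join_meet e_meet mjl e_e.
by rewrite -mjl -mul_e_join mjr (mC y x).
Qed.
Let mul_mul_join x y z : x * (y * (x + z)) = x * y + z * 0.
Proof.
by rewrite (mjr y) mjr (mC y x) mulKm -mjr addMe mul_add0 (mC y).
Qed.
Let mul_add_absorb x y z : x * (y * z) + y * 0 = x * (y * z).
Proof. by rewrite (mC x) -mul_add0 -mjr j0. Qed.
Let mul_meet_meet x y z : (y * z) * (x * y) = x * (y * z).
Proof.
rewrite {1}(mC y z) (mC (z * y)) -mul_add_absorb -mul_add0.
rewrite -(mul_add_absorb x y) (mC x (y * z)).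
by rewrite -(mul_mul_join (y * z)) (jC (y * z)) addMe (mul_add0 y x) (mC y x) (mC z).
Qed.

(** By [mul_meet_meet], x * (y * z) equals (y * z) * (x * y), which by commutativity is unchanged
    when x and z are exchanged. *)
Lemma distributive_bisemilattice_assoc : associative m.
Proof.
move=> x y z.
by rewrite -mul_meet_meet mC (mC y z) (mC x y) mul_meet_meet mC (mC y).
Qed.

End DistributiveBisemilattice.

(** * Members of S as distributive bisemilattices with involution *)

Definition meet (A : zroupoid) (x y : A) : A := (x ~> y^')^'.
Definition join (A : zroupoid) (x y : A) : A := x^' ~> y.

Section Symmetric.
Variable A : zroupoid.
Hypothesis hA : symmetric_implication_zroupoids A.
Implicit Types x y z u v w c : A.

Lemma negK : involutive (@neg A).
Proof. by case: hA => _ []. Qed.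

Lemma impE x y : x ~> y = join x^' y.
Proof. by rewrite /join negK. Qed.

Lemma neg_meet x y : (meet x y)^' = join x^' y^'.
Proof. by rewrite /meet /join !negK. Qed.

Lemma neg_join x y : (join x y)^' = meet x^' y^'.
Proof. by rewrite /meet /join !negK. Qed.

Lemma meetC : commutative (@meet A).
Proof. by case: hA => _ [] _ h x y; apply: h. Qed.

Lemma joinC : commutative (@join A).
Proof. by move=> x y; apply: (can_inj negK); rewrite !neg_join meetC. Qed.

Lemma join0 : right_id (zero : A) (@join A).
Proof. exact: negK. Qed.

Lemma meet1 : right_id (one : A) (@meet A).
Proof. by move=> x; rewrite /meet negK; exact: negK. Qed.

(** The defining identity of implication zroupoids, taken at the triple y, z', x, is this law up to
    commutativity. *)
Lemma join_meetr : right_distributive (@join A) (@meet A).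
Proof.
move=> x y z; rewrite joinC (joinC x z).
by case: hA => [[h _] _]; rewrite /join {1}/meet negK h.
Qed.

Lemma meet_joinr : right_distributive (@meet A) (@join A).
Proof.
by move=> x y z; apply: (can_inj negK); rewrite neg_meet !neg_join !neg_meet join_meetr.
Qed.

Lemma meetxx : idempotent_op (@meet A).
Proof.
exact: (distributive_units_idem meetC joinC meet1 join0 join_meetr meet_joinr).
Qed.

Lemma joinxx : idempotent_op (@join A).
Proof. by move=> x; apply: (can_inj negK); rewrite neg_join meetxx. Qed.

Lemma meetA : associative (@meet A).
Proof.
exact: (distributive_bisemilattice_assoc meetC joinC meet1 join0 join_meetr
          meet_joinr joinxx).
Qed.

Lemma joinA : associative (@join A).
Proof. by move=> x y z; apply: (can_inj negK); rewrite !neg_join meetA. Qed.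

Lemma join_meetl : left_distributive (@join A) (@meet A).
Proof. by move=> x y z; rewrite !(joinC _ z) join_meetr. Qed.

Lemma meet_joinl : left_distributive (@meet A) (@join A).
Proof. by move=> x y z; rewrite !(meetC _ z) meet_joinr. Qed.

Lemma joinAC : right_commutative (@join A).
Proof. by move=> x y z; rewrite -joinA (joinC y) joinA. Qed.

Lemma meetAC : right_commutative (@meet A).
Proof. by move=> x y z; rewrite -meetA (meetC y) meetA. Qed.

Lemma joinACA : interchange (@join A) (@join A).
Proof. by move=> x y z t; rewrite !joinA (joinAC x). Qed.

Lemma meetACA : interchange (@meet A) (@meet A).
Proof. by move=> x y z t; rewrite !meetA (meetAC x). Qed.

End Symmetric.

(** * Terms and literals *)

Definition supp (A : zroupoid) (x : A) : A := meet x zero.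

Inductive term := Var of nat | Zero | Imp of term & term.

(** As terms form a zroupoid, [bracketing] builds the sides of a law syntactically, and [eval] into
    [terms] is substitution. *)
Definition terms : zroupoid := @Zroupoid term Imp Zero.

Fixpoint eval (A : zroupoid) (v : nat -> A) (t : terms) : A :=
  match t with
  | Var n => v n
  | Zero => zero
  | Imp s t => eval v s ~> eval v t
  end.

Definition literal : Type := (nat * bool)%type.

(** The flag [b] is a polarity: [false] evaluates the negation of [t], pushed down to the literals.
    The values of x and x' under [r] are independent. *)
Fixpoint leval (A : zroupoid) (r : literal -> A) (b : bool) (t : terms) : A :=
  match t with
  | Var n => r (n, b)
  | Zero => if b then zero else one
  | Imp s t => (if b then @join A else @meet A) (leval r (~~ b) s) (leval r b t)
  end.

Fixpoint lits (b : bool) (t : terms) : seq literal :=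
  match t with
  | Var n => [:: (n, b)]
  | Zero => [::]
  | Imp s t => lits (~~ b) s ++ lits b t
  end.

Definition signed (A : zroupoid) (v : nat -> A) (l : literal) : A :=
  if l.2 then v l.1 else (v l.1)^'.

Definition two : zroupoid := @Zroupoid bool implb false.

Definition bval (A : zroupoid) (b : two) : A := if b then one else zero.

Lemma eq_leval (A : zroupoid) (r r' : literal -> A) b t :
  {in lits b t, r =1 r'} -> leval r b t = leval r' b t.
Proof.
elim: t b => [n|//|s IHs t IHt] b h /=; first by apply: h; rewrite mem_head.
by rewrite (IHs (~~ b)) ?(IHt b) // => l hl; apply: h; rewrite mem_cat hl ?orbT.
Qed.

Lemma eval_eval (A : zroupoid) (v : nat -> A) (f : nat -> terms) t :
  eval v (eval f t) = eval (eval v \o f) t.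
Proof. by elim: t => //= s -> t ->. Qed.

Lemma eval_bracketing (A : zroupoid) (v : nat -> A) p (s : seq terms) :
  eval v (bracketing p s) = bracketing p (map (eval v) s).
Proof.
by case: s => [|a [|b [|c [|d [|e s]]]]]; case: p => [|[|[|[|[|[|p]]]]]].
Qed.

Section LiteralEvaluation.
Variable A : zroupoid.
Hypothesis hA : symmetric_implication_zroupoids A.
Implicit Types x y z u v w c : A.
Implicit Type r : literal -> A.

Let negK := negK hA.
Let meetC := meetC hA.
Let joinC := joinC hA.
Let meetA := meetA hA.
Let joinA := joinA hA.
Let joinAC := joinAC hA.
Let meetACA := meetACA hA.
Let joinACA := joinACA hA.
Let meetxx := meetxx hA.
Let joinxx := joinxx hA.
Let meet1 := meet1 hA.
Let join0 := join0 hA.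
Let join_meetr := join_meetr hA.
Let join_meetl := join_meetl hA.
Let meet_joinr := meet_joinr hA.
Let meet_joinl := meet_joinl hA.

Lemma join0l : left_id (zero : A) (@join A).
Proof. by move=> x; rewrite joinC join0. Qed.

Lemma meet1l : left_id (one : A) (@meet A).
Proof. by move=> x; rewrite meetC meet1. Qed.

Lemma join_meetK x y : join x (meet x y) = meet x (join x y).
Proof. by rewrite join_meetr joinxx. Qed.

Lemma join_supp x y : join x (supp y) = meet x (join x y).
Proof. by rewrite /supp join_meetr join0 meetC. Qed.

Lemma join_suppl x : join x (supp x) = x.
Proof. by rewrite join_supp joinxx meetxx. Qed.

Lemma supp_join x y : supp (join x y) = join (supp x) (supp y).
Proof. exact: meet_joinl. Qed.

(** Together with [supp_join], this makes the fibre of a value depend only on the literals occurring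
    in the term. *)
Lemma supp_meet x y : supp (meet x y) = join (supp x) (supp y).
Proof.
rewrite join_supp -join_meetK /supp -meetA (meetC y) meetA.
by rewrite -{1}(join0 y) meet_joinr -(meetA x zero zero) meetxx joinC.
Qed.

Lemma supp0 : supp (zero : A) = zero.
Proof. exact: meetxx. Qed.

Lemma supp1 : supp (one : A) = zero.
Proof. exact: meet1l. Qed.

Lemma supp_supp x : supp (supp x) = supp x.
Proof. by rewrite /supp -meetA meetxx. Qed.

(* Cancellation in a distributive lattice, for elements whose fibre lies above
   that of [w]. *)
Lemma cancel_join_meet w u v :
  join u (supp w) = u -> join v (supp w) = v ->
  join u w = join v w -> meet u w = meet v w -> u = v.
Proof.
move=> hu hv hj hm.
rewrite -hu join_supp hj meet_joinr hm (meetC u).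
by rewrite -meet_joinr hj -join_supp.
Qed.

(** A Shannon expansion step: [s0] and [s1] stand for s with w replaced by 0 and by 1, likewise for
    t. Joining with c puts both sides in fibres above that of w, where cancellation applies. *)
Lemma split_congr w c (s s0 s1 t t0 t1 : A) :
  join c (supp w) = c ->
  join s w = join s0 w -> meet s w = meet s1 w ->
  join t w = join t0 w -> meet t w = meet t1 w ->
  join s0 c = join t0 c -> join s1 c = join t1 c -> join s c = join t c.
Proof.
move=> hc sj sm tj tm e0 e1; apply: (@cancel_join_meet w).
- by rewrite -joinA hc.
- by rewrite -joinA hc.
- by rewrite joinAC sj joinAC e0 joinAC -tj joinAC.
- by rewrite meet_joinl sm -meet_joinl e1 meet_joinl -tm -meet_joinl.
Qed.

Lemma leval_join r r' w b t :
  (forall l, join (r l) w = join (r' l) w) ->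
  join (leval r b t) w = join (leval r' b t) w.
Proof.
move=> h; elim: t b => [n|//|s IHs t IHt] b //=.
case: b => /=; last by rewrite !join_meetl IHs IHt.
by rewrite -(joinxx w) !(joinACA _ _ w) IHs IHt.
Qed.

Lemma leval_meet r r' w b t :
  (forall l, meet (r l) w = meet (r' l) w) ->
  meet (leval r b t) w = meet (leval r' b t) w.
Proof.
move=> h; elim: t b => [n|//|s IHs t IHt] b //=.
case: b => /=; first by rewrite !meet_joinl IHs IHt.
by rewrite -(meetxx w) !(meetACA _ _ w) IHs IHt.
Qed.

Lemma leval_signed (v : nat -> A) b t :
  leval (signed v) b t = if b then eval v t else (eval v t)^'.
Proof.
elim: t b => [n []|[]|s IHs t IHt []] //=; rewrite IHs IHt /=.
  by rewrite impE.
by rewrite impE // neg_join // negK.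
Qed.

Lemma bval_join (a b : two) : bval A (join a b) = join (bval A a) (bval A b).
Proof.
have h1 : join (one : A) zero = one by rewrite join0.
by case: a b => [] []; rewrite /bval /= ?join0l ?joinxx ?h1.
Qed.

Lemma bval_meet (a b : two) : bval A (meet a b) = meet (bval A a) (bval A b).
Proof.
have h1 : meet (zero : A) one = zero by rewrite meet1.
by case: a b => [] []; rewrite /bval /= ?meet1l ?meetxx ?h1.
Qed.

Lemma leval_bval (r : literal -> two) b t :
  leval (fun l => bval A (r l)) b t = bval A (leval r b t).
Proof.
elim: t b => [n b|[]|s IHs t IHt b] //=.
by rewrite IHs IHt; case: b; rewrite ?bval_join ?bval_meet.
Qed.

Lemma bval_neg (b : two) : bval A b^' = (bval A b)^'.
Proof. by case: b => //=; rewrite negK. Qed.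

Definition sub_supp x y := join (supp y) (supp x) = supp y.

Lemma sub_supp_anti x y : sub_supp x y -> sub_supp y x -> supp x = supp y.
Proof. by rewrite /sub_supp joinC => -> . Qed.

Lemma sub_supp_refl x : sub_supp x x.
Proof. exact: joinxx. Qed.

Lemma sub_supp_leval r b t l : l \in lits b t -> sub_supp (r l) (leval r b t).
Proof.
rewrite /sub_supp.
elim: t b => [n|//|s IHs t IHt] b /=; first by rewrite inE => /eqP ->.
rewrite mem_cat => /orP [/IHs|/IHt] h; case: b h => /= h;
  rewrite ?supp_join ?supp_meet -?joinA ?h //.
all: by rewrite joinC -joinA (joinC (supp (r l))) h joinC.
Qed.

Lemma leval_sub_supp r b t y :
  (forall l, l \in lits b t -> sub_supp (r l) y) -> sub_supp (leval r b t) y.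
Proof.
elim: t b => [n b h|b h|s IHs t IHt b h] /=.
- by apply: h; rewrite mem_head.
- by rewrite /sub_supp; case: b {h} => /=; rewrite ?supp0 ?supp1 ?join0.
have hs : sub_supp (leval r (~~ b) s) y.
  by apply: IHs => l hl; apply: h; rewrite mem_cat hl.
have ht : sub_supp (leval r b t) y.
  by apply: IHt => l hl; apply: h; rewrite mem_cat hl orbT.
by rewrite /sub_supp; case: b {h} hs ht => /= hs ht;
   rewrite ?supp_join ?supp_meet joinA hs ht.
Qed.

End LiteralEvaluation.

(** * Expansion along literals *)

Definition same_supp (A : zroupoid) : Prop := forall x : A, supp x = supp x^'.

Definition boolean_fibres (A : zroupoid) : Prop :=
  forall x : A, join x x^' = join one (join (supp x) (supp x^')).

Definition degenerate (A : zroupoid) : Prop := zero = one :> A.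

Section Expansion.
Variable A : zroupoid.
Hypothesis hA : symmetric_implication_zroupoids A.
Implicit Types x y z u v w c : A.
Implicit Type r : literal -> A.

Let negK := negK hA.
Let meetC := meetC hA.
Let joinC := joinC hA.
Let joinA := joinA hA.
Let joinAC := joinAC hA.
Let meetxx := meetxx hA.
Let joinxx := joinxx hA.
Let join0 := join0 hA.

Definition upd r (l : literal) x : literal -> A :=
  fun k => if k == l then x else r k.

(* [- \/ r k] and [- /\ r k] are homomorphisms that do not distinguish [r k] from
   0, resp. from 1, so cancelling [r k] reduces to 0/1 values of the literal k. *)
Lemma expand_literals (ls : seq literal) (b : bool) (s t : terms) c r :
  (forall r', (forall l, if l \in ls then r' l = zero \/ r' l = one
                         else r' l = r l) -> leval r' b s = leval r' b t) ->
  (forall l, l \in ls -> join c (supp (r l)) = c) ->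
  join (leval r b s) c = join (leval r b t) c.
Proof.
elim: ls r => [|k ls IH] r hr hc; first by rewrite (hr r).
have step x : x = zero \/ x = one ->
  join (leval (upd r k x) b s) c = join (leval (upd r k x) b t) c.
  move=> hx; apply: IH => [r' h|l hl].
    apply: hr => l; rewrite inE; have := h l; rewrite /upd.
    case: eqP => [-> | _] //=.
    by case: ifP => // _ ->.
  rewrite /upd; case: eqP => [_|_]; last by apply: hc; rewrite inE hl orbT.
  by case: hx => ->; rewrite ?(supp0 hA) ?(supp1 hA) join0.
apply: (split_congr hA (w := r k)) (step _ (or_introl erefl)) (step _ (or_intror erefl)).
- by apply: hc; rewrite mem_head.
- apply: (leval_join hA) => l; rewrite /upd; case: eqP => // ->.
  by rewrite joinxx (join0l hA).
- apply: (leval_meet hA) => l; rewrite /upd; case: eqP => // ->.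
  by rewrite meetxx (meet1l hA).
- apply: (leval_join hA) => l; rewrite /upd; case: eqP => // ->.
  by rewrite joinxx (join0l hA).
- apply: (leval_meet hA) => l; rewrite /upd; case: eqP => // ->.
  by rewrite meetxx (meet1l hA).
Qed.

Definition updb r (n : nat) (e : two) : literal -> A :=
  fun l => if l.1 == n then bval A (e (+) ~~ l.2) else r l.

(* When fibres are Boolean, x and x' can be expanded jointly, by the same argument
   with [w := x \/ supp x'], which lies in the fibre generated by both. *)
Lemma expand_variables (ns : seq nat) (b : bool) (s t : terms) c r :
  boolean_fibres A ->
  (forall n, n \in ns -> r (n, false) = (r (n, true))^') ->
  (forall r', (forall n, if n \in ns
      then exists e : two, forall d, r' (n, d) = bval A (e (+) ~~ d)
      else forall d, r' (n, d) = r (n, d)) ->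
    join (leval r' b s) c = join (leval r' b t) c) ->
  (forall n d, n \in ns -> join c (supp (r (n, d))) = c) ->
  join (leval r b s) c = join (leval r b t) c.
Proof.
move=> hB; elim: ns r => [|n ns IH] r hneg hr hc.
  exact: hr.
have step (e : two) :
  join (leval (updb r n e) b s) c = join (leval (updb r n e) b t) c.
  apply: IH => [k hk|r' h|k d hk].
  - rewrite /updb /=; case: eqP => _; last by apply: hneg; rewrite inE hk orbT.
    by case: e; rewrite /= ?negK.
  - apply: hr => k; rewrite inE; have := h k; rewrite /updb /=.
    case: eqP => [-> | _] //=.
    by case: ifP => // _ h1; exists e.
  - rewrite /updb /=; case: eqP => _; last by apply: hc; rewrite inE hk orbT.
    by case: (_ (+) _); rewrite /= ?(supp0 hA) ?(supp1 hA) join0.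
set a := r (n, true).
have ra : r (n, false) = a^' by apply: hneg; rewrite mem_head.
pose w := join a (supp a^').
have suppw : supp w = join (supp a) (supp a^').
  by rewrite (supp_join hA) (supp_supp hA).
(* Joining with w identifies a with 0 and, since a \/ a' is the top of its fibre, a' with 1. *)
have h0 l : join (r l) w = join (updb r n false l) w.
  rewrite /updb; case: l => k d /=; case: eqP => [->|//]; case: d; rewrite /=.
    by rewrite /w -/a joinA joinxx (join0l hA).
  rewrite ra /w joinA (joinC a^') -joinA (join_suppl hA).
  rewrite -[X in join one (join X _)](join_suppl hA a) -joinA joinA.
  rewrite (joinC one a) -joinA -hB.
  by rewrite joinA joinxx.
have neg_supp x : supp (supp x)^' = supp x^'.
  by rewrite /supp (neg_meet hA) meet_joinl // meet1l // join0.
(* Meeting with w identifies a with 1 and a' with 0; here [hB] is used in negated form, as a /\ a'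
   being the bottom of its fibre. *)
have h1 l : meet (r l) w = meet (updb r n true l) w.
  rewrite /updb; case: l => k d /=; case: eqP => [->|//]; case: d; rewrite /=.
    by rewrite -/a (meet1l hA) /w -(join_supp hA) (supp_supp hA).
  rewrite ra [RHS]meetC -/(supp w) suppw /w meet_joinr //.
  rewrite {2}/supp (meetA hA) meetxx -/(supp _) -{1}(negK a) meetC.
  rewrite -[X in join X _]negK (neg_meet hA) !negK (joinC a^') hB (neg_join hA) negK.
  rewrite meetC -/(supp _) (neg_join hA) (supp_meet hA) !neg_supp negK.
  by rewrite joinAC joinxx joinC.
apply: (split_congr hA (w := w)) (step false) (step true).
- by rewrite suppw joinA (hc n true) ?mem_head // -ra (hc n false) ?mem_head.
- exact: (leval_join hA).
- exact: (leval_meet hA).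
- exact: (leval_join hA).
- exact: (leval_meet hA).
Qed.
End Expansion.

(** * Sufficient conditions for an identity *)

(* Restricts attention to assignments for which x and x' are complementary;
   [same_monotone] below treats them as independent. *)
Definition bool_literals (g : nat -> two) : literal -> two :=
  fun l => g l.1 (+) ~~ l.2.

Definition same_literals (s t : terms) : Prop := lits true s =i lits true t.

Definition same_variables (s t : terms) : Prop :=
  forall n, (exists b, (n, b) \in lits true s) <-> (exists b, (n, b) \in lits true t).

Definition same_monotone (s t : terms) : Prop :=
  forall r : literal -> two, leval r true s = leval r true t.

Definition same_boolean (s t : terms) : Prop :=
  forall g : nat -> two,
    leval (bool_literals g) true s = leval (bool_literals g) true t.

Definition holds (A : zroupoid) (s t : terms) : Prop :=
  forall v : nat -> A, eval v s = eval v t.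

Section Soundness.
Variable A : zroupoid.
Hypothesis hA : symmetric_implication_zroupoids A.
Implicit Types v : nat -> A.

Lemma supp_signed v n b : same_supp A -> supp (signed v (n, b)) = supp (v n).
Proof. by case: b => // h; rewrite /signed /= -h. Qed.

Lemma supp_eval_eq s t v : same_variables s t ->
  same_literals s t \/ same_supp A -> supp (eval v s) = supp (eval v t).
Proof.
have evalE u : eval v u = leval (signed v) true u by rewrite leval_signed.
rewrite !evalE => hV hL; apply: (sub_supp_anti hA); apply: (leval_sub_supp hA).
  move=> [n b] hl; case: hL => h; first by apply: (sub_supp_leval hA); rewrite -h.
  have [|d hd] := (hV n).1; first by exists b.
  have := sub_supp_leval hA (signed v) hd.
  by rewrite /sub_supp !supp_signed.
move=> [n b] hl; case: hL => h; first by apply: (sub_supp_leval hA); rewrite h.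
have [|d hd] := (hV n).2; first by exists b.
have := sub_supp_leval hA (signed v) hd.
by rewrite /sub_supp !supp_signed.
Qed.

Lemma sub_supp_eval s t v : supp (eval v s) = supp (eval v t) ->
  forall l, l \in lits true s ++ lits true t ->
  join (supp (eval v s)) (supp (signed v l)) = supp (eval v s).
Proof.
have evalE u : eval v u = leval (signed v) true u by rewrite leval_signed.
rewrite !evalE => h l; rewrite mem_cat => /orP [|] hl.
  exact: (sub_supp_leval hA).
by rewrite h; apply: (sub_supp_leval hA).
Qed.

(** Joining either side with the common support changes nothing, so the expansion lemmas apply with
    this support as c. *)
Lemma eval_eq_join_supp s t v : supp (eval v s) = supp (eval v t) ->
  join (leval (signed v) true s) (supp (eval v s)) =
    join (leval (signed v) true t) (supp (eval v s)) ->
  eval v s = eval v t.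
Proof.
move=> h; rewrite !(leval_signed hA) (join_suppl hA) => ->.
by rewrite h (join_suppl hA).
Qed.

Lemma bval_inhab x : x = zero \/ x = one -> exists e : two, x = bval A e.
Proof. by case=> ->; [exists false|exists true]. Qed.

Lemma join_leval_monotone s t (r : literal -> A) (c : A) : same_monotone s t ->
  (forall l, l \in lits true s ++ lits true t -> join c (supp (r l)) = c) ->
  join (leval r true s) c = join (leval r true t) c.
Proof.
move=> hM hc; apply: (expand_literals hA (ls := lits true s ++ lits true t)) => //.
move=> r' hr'; pose e l : two := `[< r' l = one >].
have he u : {subset lits true u <= lits true s ++ lits true t} ->
    leval r' true u = bval A (leval e true u).
  move=> hu; rewrite -(leval_bval hA); apply: eq_leval => l /hu hl.
  rewrite /e; have := hr' l; rewrite hl => h.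
  by case: asboolP => [->//|hn]; case: h.
by rewrite !he ?hM // => l hl; rewrite mem_cat hl ?orbT.
Qed.

Lemma holds_monotone s t : same_variables s t ->
  same_literals s t \/ same_supp A -> same_monotone s t -> holds A s t.
Proof.
move=> hV hL hM v; have hE := supp_eval_eq v hV hL.
apply: eval_eq_join_supp => //; apply: join_leval_monotone => //.
exact: sub_supp_eval.
Qed.

(** Once every literal is expanded to a constant, both sides are 0 because 0 = 1. *)
Lemma holds_degenerate s t : same_variables s t ->
  same_literals s t \/ same_supp A -> degenerate A -> holds A s t.
Proof.
move=> hV hL hT v; have hE := supp_eval_eq v hV hL.
apply: eval_eq_join_supp => //.
apply: (expand_literals hA (ls := lits true s ++ lits true t)) => [r' hr'|].
  2: exact: sub_supp_eval.
have he u : {subset lits true u <= lits true s ++ lits true t} ->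
    leval r' true u = zero.
  move=> hu; transitivity (bval A (leval (A := two) (fun=> false) true u)).
    rewrite -(leval_bval hA); apply: eq_leval => l /hu hl /=.
    by have := hr' l; rewrite hl -hT; case.
  by case: (leval _ _ _) => //; apply: esym hT.
by rewrite !he // => l hl; rewrite mem_cat hl ?orbT.
Qed.

(** Expanding x and x' jointly needs both supports below that of the sides: true if both literals
    occur, or if x and x' share a fibre. Any other variable occurs in one polarity only, so its
    literal can be expanded freely and still comes from a Boolean assignment. *)
Lemma holds_boolean s t : same_variables s t ->
  same_literals s t \/ same_supp A -> boolean_fibres A -> same_boolean s t ->
  holds A s t.
Proof.
(* Reading Boolean values back from the constants of A requires 0 and 1 to be distinct. *)
move=> hV hL hB hM v; have [hT|hT] := pselect (degenerate A).
  exact: holds_degenerate.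
have hE := supp_eval_eq v hV hL; apply: eval_eq_join_supp => //.
pose L := lits true s ++ lits true t.
have hLs l : l \in lits true s -> l \in L by move=> h; rewrite mem_cat h.
have hLt l : l \in lits true t -> l \in L by move=> h; rewrite mem_cat h orbT.
have [ns [h1 h2]] : exists ns : seq nat,
    (forall n b, n \in ns -> join (supp (eval v s)) (supp (signed v (n, b))) =
                             supp (eval v s)) /\
    (forall l, l \in L -> l.1 \notin ns -> (l.1, ~~ l.2) \notin L).
  have habs := sub_supp_eval hE.
  case: hL => hL.
    exists [seq l.1 | l <- L & ((l.1, ~~ l.2) \in L)]; split.
      move=> n b /mapP [[k d]]; rewrite mem_filter /= => /andP [h1 h2] ->.
      by apply: habs; case: b d h1 h2 => [] [].
    move=> l hl; apply: contra => h; apply/mapP; exists l => //.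
    by rewrite mem_filter h hl.
  exists [seq l.1 | l <- L]; split.
    move=> n b /mapP [[k d] hk ->] /=.
    by have := habs _ hk; rewrite !supp_signed.
  by move=> l hl; rewrite map_f.
apply: (expand_variables hA hB (ns := ns)) => [n hn //|r1 hr1|n d hn].
  2: exact: h1.
apply: (expand_literals hA (ls := [seq l <- L | l.1 \notin ns])) => [r2 hr2|[n b]].
  2: rewrite mem_filter /= => /andP [/negPf hn hl].
  2: by have := hr1 n; rewrite hn => ->; exact: (sub_supp_eval hE).
pose e (l : literal) : two := `[< r2 l = one >].
(* A variable occurring only negatively is read off its negative literal. *)
pose g n : two := if (n, true) \in L then e (n, true) else ~~ e (n, false).
have bval_e (x : two) l : r2 l = bval A x -> e l = x.
  by rewrite /e => ->; case: x; apply/asboolP.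
have key l : l \in L -> r2 l = bval A (bool_literals g l).
  case: l => n b hl; have [hn|hn] := boolP (n \in ns).
    have [x hx] : exists x : two, forall d, r2 (n, d) = bval A (x (+) ~~ d).
      have := hr1 n; rewrite hn => -[x hx]; exists x => d; rewrite -hx.
      by have := hr2 (n, d); rewrite mem_filter /= hn.
    rewrite hx /bool_literals /g /= !(bval_e _ _ (hx _)) addbF addbT negbK.
    by case: ifP.
  have hnl := h2 _ hl hn; have := hr2 (n, b); rewrite mem_filter /= hn hl /=.
  move=> /bval_inhab [x hx]; rewrite hx /bool_literals /g.
  case: b hl hnl hx => /= hl hnl hx; first by rewrite hl (bval_e _ _ hx) addbF.
  by rewrite (negPf hnl) (bval_e _ _ hx) addbT negbK.
have he u : {subset lits true u <= L} ->
    leval r2 true u = bval A (leval (bool_literals g) true u).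
  move=> hu; rewrite -(leval_bval hA).
  by apply: eq_leval => l /hu; apply: key.
by rewrite !he ?hM.
Qed.
End Soundness.

(** * Consequences of an identity *)

Section Completeness.
Variable A : zroupoid.
Hypothesis hA : symmetric_implication_zroupoids A.
Implicit Types (x : A) (v : nat -> A).

(** When 0 = 1, [supp] is the identity. Hence a law that forces 0 = 1 needs no separate argument for
    Boolean fibres. *)
Lemma degenerate_boolean_fibres : degenerate A -> boolean_fibres A.
Proof.
rewrite /degenerate => hT x.
have suppE (y : A) : supp y = y by rewrite /supp hT (meet1 hA).
by rewrite !suppE -hT (join0l hA).
Qed.

(** Give the variable of l the value x and all others 0: one side lies in a fibre above that of l,
    while the other can involve only the opposite literal. *)
Lemma holds_sub_supp s t l x : holds A s t -> l \in lits true s ->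
  l \notin lits true t ->
  sub_supp (if l.2 then x else x^') (if l.2 then x^' else x).
Proof.
move=> h; case: l => n b hs ht /=.
pose v k := if k == n then x else zero.
have vn d : signed v (n, d) = if d then x else x^' by rewrite /signed /v /= eqxx.
have v0 k d : k != n -> supp (signed v (k, d)) = zero.
  rewrite /signed /v /= => /negPf ->.
  by case: d; rewrite ?(supp0 hA) ?(supp1 hA).
have evalE u : eval v u = leval (signed v) true u by rewrite leval_signed.
have hle := sub_supp_leval hA (signed v) hs.
have hge : sub_supp (leval (signed v) true t) (signed v (n, ~~ b)).
  apply: (leval_sub_supp hA) => -[k d] hk; have [kn|kn] := eqVneq k n.
    have -> : d = ~~ b.
      by move: hk ht; rewrite kn; case: d b {hs hle} => [] [] // ->.
    by rewrite kn; apply: (sub_supp_refl hA).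
  by rewrite /sub_supp (v0 k d) // (join0 hA).
move: hle hge; rewrite -!evalE (h v) /sub_supp !vn => hle.
have -> : (if ~~ b then x else x^') = if b then x^' else x by case: b {hs ht hle}.
by move=> <-; rewrite -(joinA hA) hle.
Qed.

Lemma holds_same_supp s t : holds A s t -> ~ same_literals s t -> same_supp A.
Proof.
move=> h hN; apply: contrapT => hS; apply: hN => l.
have key s' t' : holds A s' t' -> l \in lits true s' -> l \in lits true t'.
  move=> h' hl; apply: contrapT => /negP hn; apply: hS => x.
  have := holds_sub_supp x h' hl hn; have := holds_sub_supp x^' h' hl hn.
  rewrite (negK hA); case: l.2 => h1 h2; exact: (sub_supp_anti hA).
by apply/idP/idP; apply: key => // v; rewrite h.
Qed.

(** If 0 and 1 were distinct, [bval] would embed [two] into A and the identity would hold in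
    [two]. *)
Lemma holds_degenerate_inv s t : holds A s t -> ~ same_boolean s t -> degenerate A.
Proof.
move=> h hN; apply: contrapT => hT; apply: hN => g.
have bval_inj (a b : two) : bval A a = bval A b -> a = b.
  by case: a b => [] [] //= e; case: hT; rewrite /degenerate e.
have evalE u : eval (fun n => bval A (g n)) u = bval A (leval (bool_literals g) true u).
  rewrite -(leval_bval hA) -(leval_signed hA (fun n => bval A (g n)) true u).
  apply: eq_leval => -[n b] _; rewrite /signed /bool_literals /=.
  by case: b; rewrite /= ?addbF // addbT -(bval_neg hA); case: (g n).
by apply: bval_inj; rewrite -!evalE.
Qed.

Lemma holds_subst s t (f : nat -> terms) :
  holds A s t -> holds A (eval f s) (eval f t).
Proof. by move=> h v; rewrite !eval_eval. Qed.

Lemma holds_neg s t : holds A s t -> holds A (Imp s Zero) (Imp t Zero).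
Proof. by move=> h v /=; rewrite h. Qed.

(* The sides have the same Boolean values, 1, but differ where x = x' = 0. *)
Lemma holds_excluded_middle s t : holds A s t ->
  same_monotone s (Imp Zero Zero) -> same_monotone t (Imp (Var 0) (Var 0)) ->
  boolean_fibres A.
Proof.
move=> h hs ht x; pose v (n : nat) := x; pose c := join (supp x) (supp x^').
have key u u' : same_monotone u u' -> join (eval v u) c = join (eval v u') c.
  move=> hM.
  have evalE w : eval v w = leval (signed v) true w by rewrite leval_signed.
  rewrite !evalE; apply: (join_leval_monotone hA) => // -[n d] _.
  rewrite /signed /c /v; case: d => /=; first by rewrite (joinAC hA) (joinxx hA).
  by rewrite -(joinA hA) (joinxx hA).
have := key _ _ ht; rewrite -(h v) (key _ _ hs) /= (impE hA x) => ->.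
by rewrite /c (joinC hA x^') (joinACA hA) !(join_suppl hA).
Qed.

End Completeness.

(** * Profiles of the weak associative laws *)

Fixpoint seqs_over (T : Type) (s : seq T) (n : nat) : seq (seq T) :=
  if n is n'.+1 then [seq x :: u | x <- s, u <- seqs_over s n'] else [:: [::]].

Lemma mem_seqs_over (T : eqType) (s : seq T) (u : seq T) :
  {subset u <= s} -> u \in seqs_over s (size u).
Proof.
elim: u => //= x u IH h; apply/allpairsP; exists (x, u) => /=; split => //.
  by apply: h; rewrite mem_head.
by apply: IH => y hy; apply: h; rewrite inE hy orbT.
Qed.

(** The literals x' and x of variable n occupy positions 2n and 2n + 1, whence the [n.*2] bits in
    [same_monotoneb]. *)
Definition bits_literals (u : seq bool) : literal -> two :=
  fun l => nth false u (l.1.*2 + l.2).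

Definition below (n : nat) (s t : terms) : bool :=
  all (fun l => l.1 < n) (lits true s ++ lits true t).

Definition same_literalsb (s t : terms) : bool :=
  all (mem (lits true t)) (lits true s) && all (mem (lits true s)) (lits true t).

Definition sub_variablesb (s t : terms) : bool :=
  all (fun l => has (fun k => k.1 == l.1) (lits true t)) (lits true s).

Definition same_monotoneb (n : nat) (s t : terms) : bool :=
  all (fun u => leval (bits_literals u) true s == leval (bits_literals u) true t :> bool)
    (seqs_over [:: false; true] n.*2).

Definition same_booleanb (n : nat) (s t : terms) : bool :=
  all (fun u => let r := bool_literals (nth false u) in
                leval r true s == leval r true t :> bool)
    (seqs_over [:: false; true] n).

Lemma same_literalsP s t : reflect (same_literals s t) (same_literalsb s t).
Proof.
apply: (iffP andP) => [[/allP h1 /allP h2] l|h].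
  by apply/idP/idP => [/h1|/h2].
by split; apply/allP => l; rewrite /= h.
Qed.

Lemma sub_variablesP s t : sub_variablesb s t ->
  forall n, (exists b, (n, b) \in lits true s) -> exists b, (n, b) \in lits true t.
Proof.
move=> /allP h n [b /h /hasP [[k d] hk /= /eqP e]].
by exists d; rewrite -e.
Qed.

Lemma eq_leval_below n s t (r r' : literal -> two) : below n s t ->
  (forall l, l.1 < n -> r l = r' l) ->
  leval r true s = leval r' true s /\ leval r true t = leval r' true t.
Proof.
by move=> /allP hn h; split; apply: eq_leval => l hl; apply: h; apply: hn;
  rewrite mem_cat hl ?orbT.
Qed.

Lemma same_monotonebP n s t : below n s t -> same_monotoneb n s t -> same_monotone s t.
Proof.
move=> hn /allP h r.
pose u : seq bool := mkseq (fun i => r (i./2, odd i)) n.*2.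
have [] := eq_leval_below (r := r) (r' := bits_literals u) hn.
  move=> [k d] /= hk; rewrite /bits_literals /= nth_mkseq.
    by rewrite addnC half_bit_double oddD odd_double addbF oddb.
  apply: leq_trans (_ : k.+1.*2 <= _); last by rewrite leq_double.
  by case: d; rewrite doubleS ?addn0 ?addn1 // ltnW.
move=> -> ->; apply/eqP/h.
by have := @mem_seqs_over _ [:: false; true] u; rewrite size_mkseq; apply=> -[].
Qed.

Lemma same_booleanbP n s t : below n s t ->
  reflect (same_boolean s t) (same_booleanb n s t).
Proof.
move=> hn; apply: (iffP allP) => [h g|h u _]; last by apply/eqP/h.
pose u : seq bool := mkseq g n.
have [] := eq_leval_below (r := bool_literals g) (r' := bool_literals (nth false u)) hn.
  by move=> [k d] /= hk; rewrite /bool_literals /= nth_mkseq.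
move=> -> ->; apply/eqP/h.
by have := @mem_seqs_over _ [:: false; true] u; rewrite size_mkseq; apply=> -[].
Qed.

Definition excluded_middleb (s t : terms) : bool :=
  [&& below 1 s (Imp Zero Zero), below 1 t (Imp (Var 0) (Var 0)),
      same_monotoneb 1 s (Imp Zero Zero) &
      same_monotoneb 1 t (Imp (Var 0) (Var 0))].

Definition one_variable_terms : seq terms :=
  [:: (Zero : terms); Imp Zero Zero; Var 0; Imp (Var 0) Zero].

(** Searches the substitutions of 0, 1, x, x' for an instance that, possibly after swapping or
    negating the sides, reads 1 = x \/ x', as [holds_excluded_middle] requires. *)
Definition excluded_middle_instanceb (s t : terms) : bool :=
  has (fun u => let s' := eval (nth (Zero : terms) u) s in
                let t' := eval (nth (Zero : terms) u) t in
         [|| excluded_middleb s' t', excluded_middleb t' s',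
             excluded_middleb (Imp s' Zero) (Imp t' Zero) |
             excluded_middleb (Imp t' Zero) (Imp s' Zero)])
    (seqs_over one_variable_terms 4).

Lemma excluded_middle_instancebP (A : zroupoid) s t :
  symmetric_implication_zroupoids A -> holds A s t ->
  excluded_middle_instanceb s t -> boolean_fibres A.
Proof.
move=> hA h /(has_nthP [::]) [i _]; set f := nth _ _.
have em a b : holds A a b -> excluded_middleb a b -> boolean_fibres A.
  move=> hab /and4P [na nb ha hb].
  exact: (holds_excluded_middle hA hab (same_monotonebP na ha) (same_monotonebP nb hb)).
have hf : holds A (eval f s) (eval f t) by apply: holds_subst.
have hf' : holds A (eval f t) (eval f s) by move=> v; rewrite hf.
case/or4P; apply: em => //; exact: holds_neg.
Qed.

Definition lhs (l : law) : terms := bracketing l.1.2 (map (Var : nat -> terms) l.1.1).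
Definition rhs (l : law) : terms := bracketing l.2 (map (Var : nat -> terms) l.1.1).

Lemma satisfiesE (A : zroupoid) (l : law) : satisfies A l <-> holds A (lhs l) (rhs l).
Proof.
case: l => [[w p] q]; rewrite /satisfies /holds /lhs /rhs /=.
by split=> h v; have := h v; rewrite !eval_bracketing -!map_comp.
Qed.

(* Its bits are the sameness of literals, of Boolean functions, and of monotone
   functions of the literals. *)
Definition profile (l : law) : bool * bool * bool :=
  (same_literalsb (lhs l) (rhs l), same_booleanb 4 (lhs l) (rhs l),
   same_monotoneb 4 (lhs l) (rhs l)).

Definition profile_variety (p : bool * bool * bool) : set zroupoid :=
  symmetric_implication_zroupoids `&`
  [set A | (p.1.1 \/ same_supp A) /\ (p.1.2 \/ degenerate A) /\
           (p.2 \/ boolean_fibres A)].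

(** The essential part is the last conjunct: sides equal as Boolean but not as monotone functions
    always have an instance forcing Boolean fibres. *)
Lemma law_profiles_checked :
  all (fun l => [&& below 4 (lhs l) (rhs l), sub_variablesb (lhs l) (rhs l),
                    sub_variablesb (rhs l) (lhs l) &
                    [|| (profile l).2, ~~ (profile l).1.2 |
                        excluded_middle_instanceb (lhs l) (rhs l)]])
    weak_associative_laws.
Proof. by vm_compute. Qed.

Lemma law_varietyE l : l \in weak_associative_laws ->
  law_variety l = profile_variety (profile l).
Proof.
move=> /(allP law_profiles_checked) /and4P [hn hv1 hv2 hp].
have hV : same_variables (lhs l) (rhs l).
  by move=> n; split; apply: sub_variablesP.
rewrite eqEsubset; split => A [hA h]; split => //.
  move/satisfiesE: h => h; split; [|split] => /=.
  - have [hL|/same_literalsP hL] := boolP (same_literalsb _ _); first by left.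
    by right; apply: (holds_same_supp hA h).
  - have [hB|/(same_booleanbP hn) hB] := boolP (same_booleanb _ _ _); first by left.
    by right; apply: (holds_degenerate_inv hA h).
  case/or3P: hp => [|/(same_booleanbP hn) hB|]; first by left.
    by right; apply/(degenerate_boolean_fibres hA)/(holds_degenerate_inv hA h).
  by move=> hex; right; apply: (excluded_middle_instancebP hA h).
apply/satisfiesE; case: h => /= hL [hB hM].
have hL' : same_literals (lhs l) (rhs l) \/ same_supp A.
  by case: hL => [/same_literalsP|]; [left|right].
case: hM => [/(same_monotonebP hn) hM|hM]; first exact: holds_monotone.
case: hB => [/(same_booleanbP hn) hB|hB]; first exact: holds_boolean.
exact: holds_degenerate.
Qed.

(** * The six varieties *)

(** Listed in the order of [six_varieties]; the two missing triples have equal monotone but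
    different Boolean functions. *)
Definition six_profiles : 6.-tuple (bool * bool * bool) :=
  [tuple (false, false, false); (false, true, false); (true, false, false);
         (false, true, true); (true, true, false); (true, true, true)].

Lemma SL_profile : SL = profile_variety (false, false, false).
Proof.
rewrite eqEsubset; split => A.
  move=> [hI [hN hC]].
  have hA : symmetric_implication_zroupoids A.
    by split=> //; split=> [x|x y]; rewrite !hN.
  have hT : degenerate A by rewrite /degenerate hN.
  split=> //; split; first by right=> x; rewrite hN.
  by split; right => //; apply: degenerate_boolean_fibres.
move=> [hA [[//|hS] [[//|hT] _]]].
have suppE (x : A) : supp x = x by rewrite /supp hT (meet1 hA).
have hN (x : A) : x^' = x by rewrite -[RHS]suppE hS suppE.
split; first by case: hA.
by split=> // x y; rewrite !(impE hA) !hN (joinC hA).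
Qed.

Lemma six_varietiesE i : tnth six_varieties i = profile_variety (tnth six_profiles i).
Proof.
case: i => [[|[|[|[|[|[|//]]]]]] hi];
  rewrite !(tnth_nth set0) !(tnth_nth (false, false, false)) /=.
- exact: SL_profile.
- by rewrite /V43A12 law_varietyE.
- by rewrite /V43A23 law_varietyE.
- by rewrite /V42A12 law_varietyE.
- by rewrite /V43F25 law_varietyE.
rewrite eqEsubset; split=> A; last by case.
by move=> hA; split=> //; split; [left|split; left].
Qed.

(** * Small algebras separating the varieties *)

Definition semilattice2 : zroupoid := @Zroupoid bool orb false.

(** A semilattice whose involution swaps coordinates: 0 = 1 and [supp] is the identity, so only
    [same_supp] fails. *)
Definition involutive_semilattice4 : zroupoid :=
  @Zroupoid (bool * bool) (fun a b => (a.2 || b.1, a.1 || b.2)) (false, false).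

(** The four-element De Morgan algebra; a pair gives independent truth values to x and x'. It has a
    single fibre, which is not Boolean since negation fixes [(true, true)]. *)
Definition de_morgan4 : zroupoid :=
  @Zroupoid (bool * bool) (fun a b => (a.2 || b.1, a.1 && b.2)) (false, true).

Lemma two_profile p : profile_variety p two <-> p.1.2.
Proof.
split=> [[_ /= [_ [[//|h] _]]] //|hp].
split; first by split; split => //; [move=> [] [] [] | case | move=> [] []].
by split; [right; case|split; [left|right; case]].
Qed.

Lemma involutive_semilattice4_profile p :
  profile_variety p involutive_semilattice4 <-> p.1.1.
Proof.
split=> [[_ /= [[//|h] _]]|hp]; first by have := h (true, false).
split; first by split; split => //; [move=> [[] []] [[] []] [[] []] | move=> [[] []]
  | move=> [[] []] [[] []]].
by split; [left|split; right => //; move=> [[] []]].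
Qed.

Lemma de_morgan4_profile p : profile_variety p de_morgan4 <-> p.1.2 && p.2.
Proof.
split=> [[_ /= [_ [h h']]]|/andP [hp hp']].
  apply/andP; split; first by case: h.
  by case: h' => // h'; have := h' (true, true).
split; first by split; split => //; [move=> [[] []] [[] []] [[] []] | move=> [[] []]
  | move=> [[] []] [[] []]].
by split; [right; move=> [[] []]|split; left].
Qed.

Lemma profile_variety_sub (p q : bool * bool * bool) :
  [&& p.1.1 ==> q.1.1, p.1.2 ==> q.1.2 & p.2 ==> q.2] ->
  profile_variety p `<=` profile_variety q.
Proof.
case/and3P => /implyP h1 /implyP h2 /implyP h3 A [hA [a [b c]]]; split => //.
split; first by case: a => [/h1|]; [left|right].
split; first by case: b => [/h2|]; [left|right].
by case: c => [/h3|]; [left|right].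
Qed.

(** Each conjunct comes from one separating algebra. As 0 and 1 differ in [de_morgan4], it detects
    the last bit only jointly with the middle one, which suffices for the six profiles. *)
Lemma profile_variety_sub_inv (p q : bool * bool * bool) :
  profile_variety p `<=` profile_variety q ->
  [&& p.1.1 ==> q.1.1, p.1.2 ==> q.1.2 & p.1.2 && p.2 ==> q.1.2 && q.2].
Proof.
move=> h; apply/and3P; split; apply/implyP.
- by move=> /(involutive_semilattice4_profile p).2 /h /involutive_semilattice4_profile.
- by move=> /(two_profile p).2 /h /two_profile.
- by move=> /(de_morgan4_profile p).2 /h /de_morgan4_profile.
Qed.

(** From 1 -> x = x and 0 -> x = 1, instances of the main axiom give x'''' = x, then x'' = x, then
    commutativity of [join]. All supports are 0. *)
Lemma BA_sub : BA `<=` profile_variety (false, true, false).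
Proof.
move=> A [[hI h00] [hK hx]].
have top_imp (x : A) : one ~> x = x by rewrite -(hx x) hK.
have neg_bot_imp (x : A) : (zero ~> x)^' = zero by apply: hK.
have neg4 (x : A) : x^'^'^'^' = x.
  by rewrite -[RHS]top_imp hI neg_bot_imp /neg.
have bot_imp (x : A) : zero ~> x = one by rewrite -[LHS]neg4 neg_bot_imp h00.
have hN (x : A) : x^'^' = x.
  have h (a b : A) : a ~> b = a ~> b^'^'.
    rewrite -[LHS]neg4 -[RHS]neg4; congr (neg (neg (neg _))). 
    by rewrite {1}/neg hI top_imp.
  by rewrite -[LHS]top_imp -h top_imp.
have jC (x y : A) : x^' ~> y = y^' ~> x.
  by rewrite {1}/neg hI bot_imp -/(neg _) !hN.
have hA : symmetric_implication_zroupoids A.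
  by split=> //; split=> // x y; rewrite -{1}(hN x) jC !hN.
have top_join (x : A) : join one x = one by rewrite /join h00 bot_imp.
split=> //; split; [right|split; [by left|right]] => x.
  have s0 (y : A) : supp y = zero.
    by rewrite /supp (meetC hA) /meet neg_bot_imp.
  by rewrite !s0.
by rewrite top_join /join hx.
Qed.

(** Shows that the inclusion of [BA] is proper: x -> x = 0' fails here at [true]. *)
Lemma semilattice2_profile : profile_variety (false, true, false) semilattice2.
Proof.
split; first by split; split => //; [move=> [] [] [] | case | move=> [] []].
by split; [right; case|split; [left|right; case]].
Qed.

Theorem theorem8p2 :
  ([set law_variety l | l in [set l | l \in weak_associative_laws]] =
     range (tnth six_varieties) /\
   injective (tnth six_varieties)) /\
  ((SL `<` V43A23 /\ V43A23 `<` V43F25 /\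
    V43F25 `<` symmetric_implication_zroupoids) /\
   (SL `<` V43A12 /\ V43A12 `<` V42A12 /\
    V42A12 `<` symmetric_implication_zroupoids) /\
   (BA `<` V43A12 /\ V43A12 `<` V43F25) /\
   (~ (V43A12 `<=` V43A23) /\ ~ (V43A23 `<=` V43A12)) /\
   (~ (V42A12 `<=` V43F25) /\ ~ (V43F25 `<=` V42A12))).
Proof.
have sixE i hi := six_varietiesE (@Ordinal 6 i hi).
have E0 := sixE 0 isT; have E1 := sixE 1 isT; have E2 := sixE 2 isT.
have E3 := sixE 3 isT; have E4 := sixE 4 isT; have E5 := sixE 5 isT.
move: E0 E1 E2 E3 E4 E5; rewrite !(tnth_nth set0) !(tnth_nth (false, false, false)) /=.
move=> E0 E1 E2 E3 E4 E5.
have proper p q : [&& p.1.1 ==> q.1.1, p.1.2 ==> q.1.2 & p.2 ==> q.2] ->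
    ~~ [&& q.1.1 ==> p.1.1, q.1.2 ==> p.1.2 & q.1.2 && q.2 ==> p.1.2 && p.2] ->
    profile_variety p `<` profile_variety q.
  by move=> h /negP h'; split; [apply: profile_variety_sub | move/profile_variety_sub_inv].
split; last first.
  rewrite E0 E1 E2 E3 E4 E5; split; first by split; [|split]; exact: proper.
  split; first by split; [|split]; exact: proper.
  split; last by split; split; move/profile_variety_sub_inv.
  split; last exact: proper.
  by split; [exact: BA_sub | move=> /(_ _ semilattice2_profile) [_ [_ /(_ true)]]].
split.
  rewrite eqEsubset; split => V [].
    move=> l hl <-; have : profile l \in six_profiles.
      by move: l hl; apply/allP; vm_compute.
    by move=> /tnthP [i hi]; exists i => //; rewrite six_varietiesE -hi law_varietyE.
  move=> i _ <-; rewrite six_varietiesE.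
  have /hasP [l hl /eqP <-] :
      has (fun l => profile l == tnth six_profiles i) weak_associative_laws.
    by apply: (allP (_ : all (fun p => has (fun l => profile l == p) _) six_profiles));
      [vm_compute | apply: mem_tnth].
  by exists l => //; rewrite law_varietyE.
move=> i j; rewrite !six_varietiesE => e.
(* Equal varieties include each other, and the two resulting criteria hold together only for equal
   indices. *)
have := @profile_variety_sub_inv (tnth six_profiles i) (tnth six_profiles j).
have := @profile_variety_sub_inv (tnth six_profiles j) (tnth six_profiles i).
rewrite e => /(_ (fun _ h => h)) h1 /(_ (fun _ h => h)) h2.
apply/eqP; move: h1 h2; clear.
rewrite !(tnth_nth (false, false, false)) -val_eqE.
by case: i j => [[|[|[|[|[|[|//]]]]]] ?] [[|[|[|[|[|[|//]]]]]] ?].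
Qed.
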